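(* Let $p=3$, $q=3^m$, $s=3^r>3$ with $\gcd(r,2m)=1$, let $a$ be a non-square in $\mathbb F_q^*$ and $e\in\mathbb F_q$. The exceptional polynomial $$f_e(x)=(x+e)\big((x+e)^2-a\big)^{(s+1)/4}\left(\frac{\big((x+e)^2-a\big)^{(s-1)/2}+a^{(s-1)/2}}{(x+e)^2}\right)^{(s+1)/2}$$ is not good over $\mathbb F_q$; that is, $f_e(x)-f_e(0)$ is not a good exceptional polynomial over $\mathbb F_q$.
   Context: A polynomial $f\in\mathbb F_q[x]$ is exceptional over $\mathbb F_q$ if it is a permutation polynomial of $\mathbb F_{q^t}$ (induces a bijection of $\mathbb F_{q^t}$) for infinitely many $t$. An exceptional polynomial $g\in\mathbb F_q[x]$ with $g(0)=0$ and $g'(0)\neq0$ is called good if the roots of $\frac{g(-x)}{-x}$ in $\overline{\mathbb F}_q$ form a unique orbit under the Frobenius map $x\mapsto x^q$ (roots as a set, without multiplicities). *)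

(* Defs.v *)
From HB Require Import structures.
From mathcomp Require Import all_boot all_order all_algebra all_field.

Set Implicit Arguments.
Unset Strict Implicit.
Unset Printing Implicit Defensive.

Import GRing.Theory.
Local Open Scope ring_scope.

Definition Fbar (F : finFieldType) : countClosedFieldType :=
  projT1 (countable_algebraic_closure F).

Definition toFbar (F : finFieldType) : {rmorphism F -> Fbar F} :=
  sval (projT2 (countable_algebraic_closure F)).

(* F_(q^t), with q = #|F|, is given as a finite field K with q^t elements
   together with an embedding of F; there is none for t = 0. *)
Definition permutation_poly_ext (F : finFieldType) (f : {poly F}) (t : nat) :
    Prop :=
  exists (K : finFieldType) (h : {rmorphism F -> K}),
    #|K| = (#|F| ^ t)%N /\ bijective (fun x : K => (map_poly h f).[x]).

Definition exceptional (F : finFieldType) (f : {poly F}) : Prop :=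
  forall N : nat, exists2 t : nat, (N < t)%N & permutation_poly_ext f t.

Definition Frob (F : finFieldType) (z : Fbar F) : Fbar F := z ^+ #|F|.

(* Frob permutes each of its orbits, which are finite, so that the forward
   iterates of z make up its whole orbit. *)
Definition roots_form_one_orbit (F : finFieldType) (h : {poly F}) : Prop :=
  exists z : Fbar F, forall w : Fbar F,
    root (map_poly (toFbar F) h) w <-> exists k : nat, w = iter k (@Frob F) z.

(* The division by - 'X is exact when g.[0] = 0. *)
Definition good (F : finFieldType) (g : {poly F}) : Prop :=
  [/\ exceptional g, g.[0] = 0, g^`().[0] != 0
    & roots_form_one_orbit ((g \Po (- 'X)) %/ (- 'X))].

(* For s = 3 ^ r with r odd, 4 divides s + 1 and (s - 1) / 2 is odd, so
   (y^2 - a)^((s - 1) / 2) + a^((s - 1) / 2) is an even polynomial in y that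
   vanishes at y = 0: all the divisions below are exact. *)
Definition f_ (F : finFieldType) (s : nat) (a e : F) : {poly F} :=
  let y := 'X + e%:P in
  let u := y ^+ 2 - a%:P in
  let n := ((s - 1) %/ 2)%N in
  y * u ^+ ((s + 1) %/ 4)
    * ((u ^+ n + (a ^+ n)%:P) %/ y ^+ 2) ^+ ((s + 1) %/ 2).

(* Main.v *)
(* Write s = 4 k - 1.  Over the algebraic closure, the Galois closure of the
   function field extension defined by f_0 is a rational function field, on
   which PSL_2(s) acts as the special unitary group of the circle
   v^(s+1) = 1.  The points of a fibre of f_0 correspond, up to sign, to the
   forms h = p X^2 + q X + p^s with q in F_s, p in F_(s^2) and
   q^2 - 4 p^(s+1) = 1: if c^2 = - 4 a, then

     y_h(v) = c h(v)^(2k) / (v^(s+1) - 1)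

   satisfies f_0(y_h(v)) = J(v) with J independent of h.  Take v with
   y_X(v) = e, the form h = X being p = 0, q = 1.  As e is rational, Frobenius
   maps y_h(v) to y_h'(v), where the middle coefficient of h' is q^#|F|.
   Unless v lies in F_(s^2), which makes e a multiple root when e <> 0, the
   value y_h(v) determines h up to sign; so roots y_h(v) with q = 0 and with
   q outside {0, 1, -1} are not conjugate.  For e = 0 the same roots are
   visible directly: y^2 = a (1 - q^2). *)
Require Import Defs.
From mathcomp Require Import all_boot all_order all_algebra all_field.
From mathcomp Require Import ring zify.
Set Implicit Arguments.
Unset Strict Implicit.
Unset Printing Implicit Defensive.
Import GRing.Theory.

Local Open Scope ring_scope.

(** * Forms on the circle and the points of a fibre *)

Definition uform (K : fieldType) (s : nat) (p q v : K) : K :=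
  p * v ^+ 2 + q * v + p ^+ s.

(* v^s times twice the polarization of uform at v and v^(-s), the conjugate
   of v with respect to the circle v^(s+1) = 1. *)
Definition polar (K : fieldType) (s : nat) (p q v : K) : K :=
  2 * p * v + q * (v * v ^+ s + 1) + 2 * p ^+ s * v ^+ s.

Definition circle (K : fieldType) (s : nat) (v : K) : K := v * v ^+ s - 1.

Definition normalized (K : fieldType) (s : nat) (p q : K) : Prop :=
  [/\ (p ^+ s) ^+ s = p, q ^+ s = q & q ^+ 2 - 4 * (p * p ^+ s) = 1].

Definition fiber_point (K : fieldType) (s k : nat) (c p q v : K) : K :=
  c * uform s p q v ^+ (2 * k) / circle s v.

(* The quotient of u^n + a^n by y^2 = u + a, where u = y^2 - a and n is odd. *)
Definition cofactor (K : comNzRingType) (n : nat) (a y : K) : K :=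
  \sum_(i < n) (y ^+ 2 - a) ^+ (n.-1 - i) * (- a) ^+ i.

(** Defined over any commutative ring, so that one expression serves for the polynomial [f_] and for
    its values, and ring morphisms relate the two. *)
Definition f_eval (K : comNzRingType) (k : nat) (a y : K) : K :=
  y * (y ^+ 2 - a) ^+ k * cofactor (2 * k).-1 a y ^+ (2 * k).

(** * Fibre points: their common value, their separation, the action of Frobenius *)

Lemma natr_frob (K : fieldType) (s n : nat) :
  [pchar K].-nat s -> (n%:R : K) ^+ s = n%:R.
Proof.
move=> hs; elim: n => [|n IH]; first by rewrite expr0n; case: s hs.
by rewrite -natr1 exprDn_pchar // IH expr1n.
Qed.

Lemma uform_frob (K : fieldType) (s : nat) (p q v : K) :
  [pchar K].-nat s -> (p ^+ s) ^+ s = p -> q ^+ s = q ->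
  uform s p q v ^+ s = p ^+ s * (v ^+ s) ^+ 2 + q * v ^+ s + p.
Proof.
move=> hs hp hq.
rewrite /uform !(exprDn_pchar _ _ hs) !exprMn hp hq.
by rewrite -expr2.
Qed.

(** With v^s held fixed, [polar] and [circle] are affine in v, and the s-th power puts v^(s^2) for v
    in the same two affine functions. The left side is thus a 2 by 2 determinant divisible by
    v^(s^2) - v. *)
Lemma polar_circle_frob (K : fieldType) (s : nat) (p q v : K) :
  [pchar K].-nat s -> (p ^+ s) ^+ s = p -> q ^+ s = q ->
  polar s p q v * circle s v ^+ s - polar s p q v ^+ s * circle s v =
  2 * ((v ^+ s) ^+ s - v) * uform s p q v ^+ s.
Proof.
move=> hs hp hq; rewrite uform_frob //.
rewrite /polar /circle !(exprDn_pchar _ _ hs) (exprNn_pchar _ hs) !exprMn.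
rewrite !(exprDn_pchar _ _ hs) !expr1n !exprMn hp hq.
ring.
Qed.

(** The classical relation between polarization, values and discriminant of a binary quadratic form,
    taken at v and v^(-s) with discriminant 1. *)
Lemma uform_norm (K : fieldType) (s : nat) (p q v : K) :
  [pchar K].-nat s -> normalized s p q ->
  4 * (uform s p q v * uform s p q v ^+ s) =
  polar s p q v ^+ 2 - circle s v ^+ 2.
Proof.
move=> hs [hp hq hd].
have -> : circle s v ^+ 2 = (q ^+ 2 - 4 * (p * p ^+ s)) * circle s v ^+ 2.
  by rewrite hd mul1r.
by rewrite uform_frob // /uform /polar /circle; ring.
Qed.

(** As 4k = s + 1, squaring produces h h^s, the norm computed in [uform_norm]. *)
Lemma fiber_point_sqr (K : fieldType) (s k : nat) (a c p q v : K) :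
  [pchar K].-nat s -> s.+1 = (4 * k)%N -> c ^+ 2 = - 4 * a ->
  normalized s p q -> circle s v != 0 ->
  fiber_point s k c p q v ^+ 2 - a = - a * (polar s p q v / circle s v) ^+ 2.
Proof.
move=> hs hk hc hf hv.
rewrite /fiber_point !exprMn hc -exprM.
have -> : (2 * k * 2 = s.+1)%N by lia.
rewrite exprS exprVn.
have -> : polar s p q v ^+ 2 =
    4 * (uform s p q v * uform s p q v ^+ s) + circle s v ^+ 2.
  by rewrite uform_norm //; ring.
by field.
Qed.

Lemma sqr_cofactor (K : comNzRingType) (n : nat) (a y : K) :
  odd n -> y ^+ 2 * cofactor n a y = (y ^+ 2 - a) ^+ n + a ^+ n.
Proof.
move=> hn; have -> : a ^+ n = - (- a) ^+ n.
  by rewrite [in RHS]exprNn -signr_odd hn mulN1r opprK.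
by rewrite subrXX; congr (_ * _); ring.
Qed.

(** Write M and D for [polar] and [circle]. As 2n = s - 1 and n is odd, u (u^n + a^n)^2 is, up to
    powers of a and D and a sign, the square of M D^s - M^s D. *)
Lemma fiber_point_branch (K : fieldType) (s k : nat) (a c p q v : K)
    (u := fiber_point s k c p q v ^+ 2 - a) (n := (2 * k).-1) :
  [pchar K].-nat s -> (0 < k)%N -> s.+1 = (4 * k)%N -> c ^+ 2 = - 4 * a ->
  normalized s p q -> circle s v != 0 ->
  u * (u ^+ n + a ^+ n) ^+ 2 =
  - a ^+ s * (2 * ((v ^+ s) ^+ s - v) * uform s p q v ^+ s
              / circle s v ^+ s.+1) ^+ 2.
Proof.
move=> hs k0 hk hc hf hv; have [hp hq _] := hf.
rewrite -polar_circle_frob // {}/u (fiber_point_sqr hs hk hc hf hv).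
have nodd : odd n by rewrite /n -subn1 oddB ?oddM //; lia.
have hsn : s = (n * 2).+1 by rewrite /n; lia.
set M := polar _ _ _ _; set D := circle _ _ in hv *.
rewrite [(- a * _) ^+ n]exprMn [(- a) ^+ n]exprNn -signr_odd nodd.
rewrite -[(_ ^+ 2) ^+ n]exprM.
rewrite hsn (mulnC 2%N) (exprS D (n * 2).+1) !(exprS _ (n * 2)) !exprM.
rewrite !exprMn !exprVn expr1.
set A := a ^+ n; set B := M ^+ n; set C := D ^+ n.
have hC : C != 0 by rewrite expf_neq0.
by field; rewrite hv hC.
Qed.

(** The factor y^s raises the exponent of y to s + 1 = 4k, which supplies a y^2 to each of the 2k
    cofactors. *)
Lemma f_eval_mul_pow (K : fieldType) (s k : nat) (a y : K)
    (u := y ^+ 2 - a) (n := (2 * k).-1) :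
  (0 < k)%N -> s.+1 = (4 * k)%N ->
  f_eval k a y * y ^+ s = (u * (u ^+ n + a ^+ n) ^+ 2) ^+ k.
Proof.
move=> k0 hk; have nodd : odd n by rewrite /n -subn1 oddB ?oddM //; lia.
rewrite -(sqr_cofactor _ _ nodd) /f_eval -/u.
set w := cofactor n a y.
transitivity (y ^+ s.+1 * u ^+ k * w ^+ (2 * k)); first by rewrite exprS; ring.
rewrite hk [RHS]exprMn -exprM exprMn -exprM.
by rewrite (_ : 2 * (2 * k) = 4 * k)%N; [ring | lia].
Qed.

(** The right-hand side is J(v): h enters f_0(y) y^s and y^s through the same power, which
    cancels. *)
Lemma f_eval_fiber_point (K : fieldType) (s k : nat) (a c p q v : K) :
  [pchar K].-nat s -> (0 < k)%N -> s.+1 = (4 * k)%N -> c ^+ 2 = - 4 * a ->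
  normalized s p q -> circle s v != 0 -> c != 0 -> uform s p q v != 0 ->
  f_eval k a (fiber_point s k c p q v) =
  (- a ^+ s) ^+ k * (2 * ((v ^+ s) ^+ s - v) / circle s v ^+ s.+1) ^+ (2 * k)
  * circle s v ^+ s / c ^+ s.
Proof.
move=> hs k0 hk hc hf hv c0 h0.
have y0 : fiber_point s k c p q v != 0 by rewrite !mulf_neq0
  ?invr_eq0 ?expf_neq0.
apply: (mulIf (expf_neq0 s y0)).
rewrite (f_eval_mul_pow _ _ k0 hk) fiber_point_branch // exprMn.
rewrite -[(_ ^+ 2) ^+ k]exprM.
have -> : fiber_point s k c p q v ^+ s =
    c ^+ s * (uform s p q v ^+ s) ^+ (2 * k) / circle s v ^+ s.
  by rewrite /fiber_point [LHS]exprMn [(c * _) ^+ s]exprMn exprVn (exprAC _ _ s).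
rewrite [2 * _ * _ / _]mulrAC [(_ * uform s p q v ^+ s) ^+ _]exprMn.
set A := (_ / _) ^+ _; set H := (_ ^+ _) ^+ (2 * k).
by field; rewrite !expf_neq0.
Qed.

(** Subtracting the s-th power of the relation gives (p - b v^s)(v - v^(s^2)) = 0. If b were
    nonzero, v^s = p / b would be fixed by the s^2-th power, and so would v. *)
Lemma unitary_line (K : fieldType) (s : nat) (p b d v : K) :
  [pchar K].-nat s -> (p ^+ s) ^+ s = p -> b ^+ s = b -> d ^+ s = d ->
  (v ^+ s) ^+ s != v -> p * v + p ^+ s * v ^+ s = b * (v * v ^+ s) + d ->
  p = 0 /\ b = 0.
Proof.
move=> hs hp hb hd hv E.
have := congr1 (fun x => x ^+ s) E.
rewrite !(exprDn_pchar _ _ hs) !exprMn hp hb hd => E'.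
have /eqP : (p - b * v ^+ s) * (v - (v ^+ s) ^+ s) = 0.
  transitivity ((p * v + p ^+ s * v ^+ s) - (p ^+ s * v ^+ s + p * (v ^+ s) ^+ s)
    - b * (v * v ^+ s) + b * (v ^+ s * (v ^+ s) ^+ s)); first by ring.
  by rewrite E E'; ring.
rewrite mulf_eq0 [X in _ || X]subr_eq0 (eq_sym v) (negbTE hv) orbF subr_eq0.
move=> /eqP pE; have [b0|b0] := eqVneq b 0; first by rewrite pE b0 mul0r.
have vE : v ^+ s = p / b by rewrite pE mulrC mulKf.
have : ((v ^+ s) ^+ s - v) ^+ s == 0.
  rewrite (exprDn_pchar _ _ hs) exprNn_pchar // vE !exprMn !exprVn hp hb hb.
  by rewrite subrr.
by rewrite expf_eq0 subr_eq0 (negbTE hv) andbF.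
Qed.

(** At a zero of h, [uform_norm] makes [polar] equal to [circle] up to a sign; [unitary_line] then
    leaves only h = X or h = - X, which vanish at v = 0 alone. *)
Lemma uform_neq0 (K : fieldType) (s : nat) (p q v : K) :
  [pchar K].-nat s -> (2 : K) != 0 -> normalized s p q ->
  (v ^+ s) ^+ s != v -> uform s p q v != 0.
Proof.
move=> hs h2 hf hv; have [hp hq _] := hf; apply/eqP => h0.
have s0 : (0 < s)%N by case/andP: hs.
have := uform_norm v hs hf.
rewrite h0 mul0r mulr0 => /esym/eqP; rewrite subr_eq0 eqf_sqr.
have key (eps : K) : eps ^+ s = eps -> eps != 0 ->
    polar s p q v = eps * circle s v -> False.
  move=> heps e0 E.
  have [|||||/eqP] := @unitary_line K s (2 * p) (eps - q) (- eps - q) v hs.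
  - by rewrite !exprMn !natr_frob // hp.
  - by rewrite (exprDn_pchar _ _ hs) (exprNn_pchar _ hs) heps hq.
  - by rewrite (exprDn_pchar _ _ hs) !(exprNn_pchar _ hs) heps hq.
  - by [].
  - rewrite exprMn natr_frob //.
    have -> : 2 * p * v + 2 * p ^+ s * v ^+ s =
        polar s p q v - q * (v * v ^+ s + 1).
      by rewrite /polar; ring.
    by rewrite E /circle; ring.
  rewrite mulf_eq0 (negbTE h2) /= => /eqP p0 /eqP; rewrite subr_eq0 => /eqP qE.
  move/eqP: h0; rewrite /uform p0 mul0r add0r expr0n -qE gtn_eqF //= addr0.
  rewrite mulf_eq0 (negbTE e0) => /= /eqP v0.
  by case/eqP: hv; rewrite v0 expr0n gtn_eqF // expr0n gtn_eqF.
case/orP => /eqP E.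
  by apply: (key 1); rewrite ?expr1n ?oner_neq0 // mul1r.
apply: (key (-1)); rewrite ?oppr_eq0 ?oner_neq0 // ?mulN1r //.
by rewrite exprNn_pchar // expr1n.
Qed.

(** By [fiber_point_sqr] equal points have equal [polar] up to a sign, and [unitary_line] applies to
    the difference of the two forms, so q and q' agree up to that sign. *)
Lemma fiber_point_inj (K : fieldType) (s k : nat) (a c p q p' q' v : K) :
  [pchar K].-nat s -> (2 : K) != 0 -> s.+1 = (4 * k)%N ->
  a != 0 -> c ^+ 2 = - 4 * a ->
  normalized s p q -> normalized s p' q' ->
  circle s v != 0 -> (v ^+ s) ^+ s != v ->
  fiber_point s k c p q v = fiber_point s k c p' q' v -> q ^+ 2 = q' ^+ 2.
Proof.
move=> hs h2 hk a0 hc hf hf' hv hvv E.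
have [hp hq _] := hf; have [hp' hq' _] := hf'.
have := congr1 (fun y => y ^+ 2 - a) E; rewrite /= !fiber_point_sqr //.
move/(mulfI _); rewrite oppr_eq0 => /(_ a0).
rewrite !exprMn => /(mulIf _); rewrite expf_neq0 ?invr_eq0 // => /(_ isT).
have key (eps : K) : eps ^+ s = eps -> polar s p q v = eps * polar s p' q' v ->
    q = eps * q'.
  move=> heps EM.
  have frob2 x y : (2 * (x - eps * y)) ^+ s = 2 * (x ^+ s - eps * y ^+ s).
    by rewrite exprMn natr_frob // (exprDn_pchar _ _ hs) (exprNn_pchar _ hs)
      exprMn heps.
  have [|||||] := @unitary_line K s (2 * (p - eps * p')) (eps * q' - q)
     (eps * q' - q) v hs.
  - by rewrite !frob2 hp hp'.
  - by rewrite (exprDn_pchar _ _ hs) (exprNn_pchar _ hs) exprMn heps hq hq'.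
  - by rewrite (exprDn_pchar _ _ hs) (exprNn_pchar _ hs) exprMn heps hq hq'.
  - by [].
  - rewrite frob2; move: EM; rewrite /polar => /eqP; rewrite -subr_eq0 => /eqP EM.
    apply/eqP; rewrite -subr_eq0 -EM; apply/eqP; ring.
  by move=> _ /eqP; rewrite subr_eq0 => /eqP.
move/eqP; rewrite eqf_sqr => /orP [] /eqP EM.
  by rewrite (key 1) ?expr1n ?mul1r.
by rewrite (key (-1)) ?mulN1r ?sqrrN // exprNn_pchar // expr1n.
Qed.

(** Rationality of e forces v^Q = z v or v^Q = z / v with z^(s+1) = 1. Both substitutions preserve
    the circle, hence carry normalized forms to normalized forms. *)
Lemma fiber_point_frob (K : fieldType) (s k Q : nat) (c p q v : K)
    (e := fiber_point s k c 0 1 v) :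
  [pchar K].-nat s -> [pchar K].-nat Q -> (0 < k)%N -> s.+1 = (4 * k)%N ->
  c != 0 -> (c ^+ Q) ^+ 2 = c ^+ 2 -> normalized s p q ->
  circle s v != 0 -> v != 0 -> e ^+ Q = e ->
  exists2 p', normalized s p' (q ^+ Q) &
    fiber_point s k c p q v ^+ Q = fiber_point s k c p' (q ^+ Q) v.
Proof.
move=> hs hQ k0 hk c0 hcQ hf hv v0 eQ; have [hp hq hd] := hf.
have s0 : (0 < s)%N by case/andP: hs.
set X := v ^+ (2 * k); set T := X ^+ Q.
(* Only c^2 is known to be fixed by the Q-th power, so [eps] is a sign. *)
set eps := c ^+ Q / c; set P := p ^+ Q.
have X0 : X != 0 by rewrite expf_neq0.
have cQ : c ^+ Q = eps * c by rewrite divfK.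
have eps2 : eps ^+ 2 = 1 by rewrite /eps exprMn exprVn hcQ divff ?expf_neq0.
have circleX : circle s v = X ^+ 2 - 1.
  by rewrite /circle -exprS hk -exprM; congr (_ ^+ _ - 1); lia.
have hX : X ^+ 2 - 1 != 0 by rewrite -circleX.
have circleT : circle s v ^+ Q = T ^+ 2 - 1.
  by rewrite circleX (exprDn_pchar _ _ hQ) (exprNn_pchar _ hQ) expr1n exprAC.
have hT : T ^+ 2 - 1 != 0 by rewrite -circleT expf_neq0.
have uformQ : uform s p q v ^+ Q =
    P * (v ^+ Q) ^+ 2 + q ^+ Q * v ^+ Q + P ^+ s.
  by rewrite /uform !(exprDn_pchar _ _ hQ) [(p * _) ^+ Q]exprMn
    [(q * v) ^+ Q]exprMn (exprAC v 2) (exprAC p s).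
have pointQ : fiber_point s k c p q v ^+ Q =
    eps * c * (uform s p q v ^+ Q) ^+ (2 * k) / (T ^+ 2 - 1).
  by rewrite /fiber_point [LHS]exprMn [(c * _) ^+ Q]exprMn exprVn cQ circleT
    (exprAC _ _ Q).
have form w : (w ^+ s) ^+ s = w -> w * w ^+ s = P * P ^+ s ->
    normalized s w (q ^+ Q).
  move=> hw hn; split=> //; first by rewrite exprAC hq.
  have := congr1 (fun x => x ^+ Q) hd.
  rewrite /= (exprDn_pchar _ _ hQ) (exprNn_pchar _ hQ) expr1n => E.
  rewrite -[RHS]E hn (exprAC q) [(4 * _) ^+ Q]exprMn natr_frob //.
  rewrite [(p * _) ^+ Q]exprMn.
  by rewrite (exprAC p s).
have root1 (z : K) : z * z ^+ s = 1 -> (z ^+ s) ^+ s = z.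
  move=> hz; have z0 : z != 0.
    by move: (oner_neq0 K); rewrite -hz mulf_eq0 negb_or => /andP[].
  have zs : z ^+ s = z^-1 by rewrite -[RHS]mulr1 -hz mulKf.
  by rewrite zs exprVn zs invrK.
have Ps : (P ^+ s) ^+ s = P by rewrite /P !(exprAC _ Q) hp.
(* Here e = c X / (X^2 - 1), and x / (x^2 - 1) takes the same value at x and at - 1 / x; this gives
   the two factors. *)
have : (X - eps * T) * (1 + eps * (X * T)) = 0.
  move: eQ; rewrite /e /fiber_point circleX /uform mul0r add0r mul1r.
  rewrite expr0n gtn_eqF // addr0 -/X [(c * X / _) ^+ Q]exprMn [(c * X) ^+ Q]exprMn exprVn cQ.
  rewrite -circleX circleT circleX -/T.
  move/(congr1 (fun x => x * (T ^+ 2 - 1) * (X ^+ 2 - 1) / c)).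
  have -> : eps * c * T / (T ^+ 2 - 1) * (T ^+ 2 - 1) * (X ^+ 2 - 1) / c =
      eps * T * (X ^+ 2 - 1) by field; rewrite hT c0.
  have -> : c * X / (X ^+ 2 - 1) * (T ^+ 2 - 1) * (X ^+ 2 - 1) / c =
      X * (T ^+ 2 - 1) by field; rewrite hX c0.
  move=> E.
  transitivity (X - eps ^+ 2 * (X * T ^+ 2) + (eps * T * (X ^+ 2 - 1))).
    by ring.
  by rewrite E eps2; ring.
(* First case, a rotation: v^Q = z v with z^(2k) = [eps], and p' = z P. *)
move/eqP; rewrite mulf_eq0 => /orP [] /eqP E.
  have TE : T = eps * X.
    by move/eqP: E; rewrite subr_eq0 => /eqP ->; rewrite mulrA -expr2 eps2 mul1r.
  have [z zE] : {z | z = v ^+ Q / v} by exists (v ^+ Q / v).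
  have vQ : v ^+ Q = z * v by rewrite zE divfK.
  have zk : z ^+ (2 * k) = eps.
    by rewrite zE exprMn exprVn (exprAC v Q) -/X -/T TE mulfK.
  have zz : z * z ^+ s = 1.
    rewrite -exprS hk -[RHS]eps2 -zk -exprM; congr (_ ^+ _); lia.
  exists (z * P).
    apply: form; first by rewrite !exprMn (root1 z) ?Ps.
    by rewrite exprMn mulrACA zz mul1r.
  have -> : fiber_point s k c p q v ^+ Q = eps * c * (uform s p q v ^+ Q) ^+ (2 * k)
      / (X ^+ 2 - 1) by rewrite pointQ TE exprMn eps2 mul1r.
  have -> : uform s p q v ^+ Q = z * uform s (z * P) (q ^+ Q) v.
    rewrite uformQ vQ /uform [(z * P) ^+ s]exprMn -[X in _ + X]mul1r -zz; ring.
  rewrite /fiber_point circleX [(z * _) ^+ _]exprMn zk mulrACA -expr2 eps2.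
  by rewrite mul1r.
(* Second case, an inversion: v^Q = z / v with z^(2k) = - [eps]. It swaps the outer coefficients,
   whence p' = z^s P^s; the sign of z^(2k) offsets that of [circle]. *)
have XT : X * T = - eps.
  rewrite -[LHS]mul1r -eps2 expr2 -mulrA.
  by move/eqP: E; rewrite addrC addr_eq0 => /eqP ->; rewrite mulrN1.
have TE : T = - eps / X by rewrite -XT mulrC mulKf.
have [z zE] : {z | z = v ^+ Q * v} by exists (v ^+ Q * v).
have vQ : v ^+ Q = z / v by rewrite zE mulfK.
have zk : z ^+ (2 * k) = - eps by rewrite zE exprMn exprAC -/X -/T mulrC.
have zz : z * z ^+ s = 1.
  rewrite -exprS hk -[RHS]eps2 -[RHS]sqrrN -zk -exprM; congr (_ ^+ _); lia.
exists (z ^+ s * P ^+ s).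
  apply: form; first by rewrite !exprMn (root1 z) ?Ps.
  by rewrite exprMn (root1 z) // Ps mulrACA (mulrC _ z) zz mul1r mulrC.
have uformE : uform s p q v ^+ Q =
    z / v ^+ 2 * uform s (z ^+ s * P ^+ s) (q ^+ Q) v.
  rewrite uformQ vQ /uform [(_ * P ^+ s) ^+ s]exprMn (root1 z) // Ps.
  rewrite -[in LHS](mul1r (P ^+ s)) -zz; by field.
rewrite pointQ uformE [(z / _ * _) ^+ _]exprMn [(z / _) ^+ _]exprMn zk exprVn.
rewrite (exprAC v) -/X.
have -> : (T ^+ 2 - 1)^-1 = - X ^+ 2 / circle s v.
  rewrite TE circleX [(- eps / X) ^+ 2]exprMn sqrrN eps2 exprVn mul1r.
  have hX' : 1 - X ^+ 2 != 0 by rewrite -opprB oppr_eq0.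
  by field; rewrite hX X0 mulN1r.
rewrite /fiber_point.
set B := uform _ _ _ _ ^+ _.
transitivity (eps ^+ 2 * (c * B / circle s v)); last by rewrite eps2 mul1r.
by field; rewrite hv X0.
Qed.

(** * Parameters over an algebraically closed field and two non-conjugate roots *)

Lemma closed_nth_root (K : closedFieldType) (n : nat) (b : K) :
  (0 < n)%N -> exists x, x ^+ n = b.
Proof.
case: n => // n _.
have [x xE] := solve_monicpoly (fun i => if i == 0%N then b else 0) (ltn0Sn n).
exists x; rewrite xE big_ord_recl /= expr0 mulr1 big1 ?addr0 // => i _.
by rewrite mul0r.
Qed.

(** Any root of 1 + x + ... + x^(n-1) works: if its square were 1, it would be 1 as n is odd, and
    the sum would be n. *)
Lemma closed_odd_unity_root (K : closedFieldType) (n : nat) :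
  odd n -> (1 < n)%N -> (n%:R : K) != 0 ->
  exists2 z : K, z ^+ n = 1 & z ^+ 2 != 1.
Proof.
case: n => // n nodd n1 nK.
have [x xE] := @solve_monicpoly K n (fun=> -1) n1.
have x1 : x ^+ n.+1 = 1.
  have S0 : \sum_(i < n.+1) x ^+ i = 0.
    rewrite big_ord_recr /= xE -big_split big1 //= => i _.
    by rewrite mulN1r; exact: subrr.
  by apply/eqP; rewrite -subr_eq0 subrX1 S0 mulr0.
exists x => //; apply/eqP => x2; move/eqP: nK; apply.
have {}x1 : x = 1.
  have nE : (n.+1 = 2 * n./2 + 1)%N by move: nodd => /=; lia.
  by move: x1; rewrite nE exprD exprM x2 expr1n mul1r.
move: xE; rewrite x1 expr1n.
rewrite (eq_bigr (fun=> -1)) => [|i _]; last by rewrite expr1n mulr1.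
by rewrite sumr_const card_ord -natr1 mulNrn => E; rewrite [X in _ + X]E subrr.
Qed.

(** For a prime power s this is surjectivity of the norm from the field of s^2 elements to that of s
    elements. *)
Lemma closed_frob_norm (K : closedFieldType) (s : nat) (b : K) :
  (0 < s)%N -> b ^+ s = b -> exists2 p : K, (p ^+ s) ^+ s = p & p * p ^+ s = b.
Proof.
move=> s0 hb; have [p pE] := closed_nth_root b (ltn0Sn s).
rewrite exprS in pE; exists p => //.
have [->|p0] := eqVneq p 0; first by rewrite expr0n gtn_eqF // expr0n gtn_eqF.
have := hb; rewrite -pE exprMn mulrC => /mulIf; apply.
by rewrite expf_neq0.
Qed.

Lemma closed_normalized (K : closedFieldType) (s : nat) (q : K) :
  [pchar K].-nat s -> (2 : K) != 0 -> q ^+ s = q -> exists p, normalized s p q.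
Proof.
move=> hs h2 hq; have s0 : (0 < s)%N by case/andP: hs.
have h4 : (4 : K) != 0 by rewrite (_ : 4 = 2 * 2) ?mulf_neq0 //; ring.
have [|p hp pE] := @closed_frob_norm K s ((q ^+ 2 - 1) / 4) s0.
  rewrite exprMn exprVn natr_frob // (exprDn_pchar _ _ hs) (exprNn_pchar _ hs).
  by rewrite expr1n exprAC hq.
by exists p; split=> //; rewrite pE; field.
Qed.

(** In x = v^(2k) the equation is the quadratic x^2 = 1 + (c / e) x. *)
Lemma closed_fiber_point_surj (K : closedFieldType) (s k : nat) (c e : K) :
  (0 < k)%N -> s.+1 = (4 * k)%N -> c != 0 -> e != 0 ->
  exists v, [/\ v != 0, circle s v != 0 & fiber_point s k c 0 1 v = e].
Proof.
move=> k0 hk c0 e0.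
have [x] := @solve_monicpoly K 2 (fun i => if i == 0%N then 1 else c / e) isT.
rewrite 2!big_ord_recl big_ord0 /= expr0 expr1 addr0 mulr1 => xE.
have x0 : x != 0.
  apply/eqP => x0; move: xE; rewrite x0 expr0n mulr0 addr0 /=.
  by move/esym/eqP; rewrite oner_eq0.
have k2 : (0 < 2 * k)%N by lia.
have [v vE] := closed_nth_root x k2.
have cE : circle s v = c / e * x.
  rewrite /circle -exprS hk (_ : 4 * k = 2 * k * 2)%N; last by lia.
  by rewrite exprM vE xE addrC addKr.
have circle0 : circle s v != 0 by rewrite cE !mulf_neq0 ?invr_eq0.
exists v; split=> //.
  by apply: contraNneq x0 => v0; rewrite -vE v0 expr0n gtn_eqF.
rewrite /fiber_point /uform mul0r add0r mul1r expr0n gtn_eqF ?addr0; last by lia.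
by rewrite vE cE; field; rewrite x0 c0 e0.
Qed.

Lemma non_conjugate_roots (K : closedFieldType) (s k Q : nat) (a e : K) :
  [pchar K].-nat s -> [pchar K].-nat Q -> (2 : K) != 0 ->
  (1 < k)%N -> s.+1 = (4 * k)%N ->
  a != 0 -> a ^+ Q = a -> e ^+ Q = e -> e ^+ 2 != a ->
  e = 0 \/ cofactor (2 * k).-1 a e != 0 ->
  exists y1 y2,
    [/\ y1 != e, y2 != e, f_eval k a y1 = f_eval k a e,
      f_eval k a y2 = f_eval k a e
      & forall j, y1 ^+ (Q ^ j) != y2 /\ y2 ^+ (Q ^ j) != y1].
Proof.
move=> hs hQ h2 k1 hk a0 aQ eQ ea hW.
have k0 : (0 < k)%N by lia.
have s0 : (0 < s)%N by case/andP: hs.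
pose n := (2 * k).-1.
have nodd : odd n by rewrite /n -subn1 oddB ?oddM //; lia.
have hsn : s = (2 * n).+1 by rewrite /n; lia.
have fixj (x : K) j : x ^+ Q = x -> x ^+ (Q ^ j) = x.
  by move=> xQ; elim: j => // j IH; rewrite expnS exprM xQ.
have Qj j : [pchar K].-nat (Q ^ j)%N by rewrite pnatX hQ.
have Qj0 j : (0 < Q ^ j)%N by case/andP: (Qj j).
(* As n = (s - 1) / 2, [l] is fixed by the s-th power and can be a middle coefficient. Since 2n + 1
   = s vanishes in K, n does not. *)
have [l ln l2] : exists2 l : K, l ^+ n = 1 & l ^+ 2 != 1.
  apply: closed_odd_unity_root => //; first by rewrite /n; lia.
  have s1 : (1 < s)%N by lia.
  have /(dvdn_pcharf (R := K)) : pdiv s \in [pchar K].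
    by apply: (pnatPpi hs); rewrite pi_pdiv.
  move/(_ s); rewrite pdiv_dvd => /esym; rewrite hsn -natr1 natrM.
  by apply: contraTneq => ->; rewrite mulr0 add0r oner_eq0.
have l0 : l != 0.
  apply: contra_eq_neq ln => ->; rewrite expr0n gtn_eqF.
    by rewrite eq_sym oner_neq0.
  by rewrite /n; lia.
have ls : l ^+ s = l by rewrite hsn exprS mulnC exprM ln expr1n mulr1.
have [e0|e0] := eqVneq e 0.
  (* At [y1] the factor u = y^2 - a vanishes; at [y2], u = - a l^2 gives u^n = - a^n, so the
     cofactor vanishes. *)
  have [y1 y1E] := @closed_nth_root K 2 a isT.
  have [y2 y2E] := @closed_nth_root K 2 (a * (1 - l ^+ 2)) isT.
  have y10 : y1 != 0 by rewrite -sqrf_eq0 y1E.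
  have y20 : y2 != 0 by rewrite -sqrf_eq0 y2E mulf_neq0 // subr_eq0 eq_sym.
  have F0 : f_eval k a 0 = 0 by rewrite /f_eval !mul0r.
  exists y1, y2; rewrite e0 F0; split=> //.
  - by rewrite /f_eval y1E subrr expr0n gtn_eqF // mulr0 mul0r.
  - have /eqP := sqr_cofactor a y2 nodd.
    rewrite {2}y2E (_ : a * _ - a = - (a * l ^+ 2)); last by ring.
    rewrite exprNn -signr_odd nodd mulN1r exprMn (exprAC l) ln expr1n mulr1.
    rewrite addNr mulf_eq0 sqrf_eq0 (negbTE y20) /= => /eqP W0.
    by rewrite /f_eval -/n W0 expr0n gtn_eqF ?mulr0 //; lia.
  move=> j; split.
    apply/eqP => /(congr1 (fun x => x ^+ 2)); rewrite /= y2E exprAC y1E fixj //.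
    move=> /eqP; rewrite -[X in X == _]mulr1 (inj_eq (mulfI a0)) eq_sym.
    by rewrite -subr_eq0 addrAC subrr add0r oppr_eq0 sqrf_eq0 (negbTE l0).
  apply/eqP => /(congr1 (fun x => x ^+ 2)); rewrite /= y1E exprAC y2E exprMn fixj //.
  rewrite (exprDn_pchar _ _ (Qj j)) expr1n (exprNn_pchar _ (Qj j)).
  move=> /eqP; rewrite -[X in _ == X]mulr1 (inj_eq (mulfI a0)).
  by rewrite -subr_eq0 addrAC subrr add0r oppr_eq0 !expf_eq0 (negbTE l0) !andbF.
have [c cE] := @closed_nth_root K 2 (- 4 * a) isT.
have c0 : c != 0.
  rewrite -sqrf_eq0 cE mulf_neq0 // oppr_eq0 (_ : 4 = 2 * 2) ?mulf_neq0 //; ring.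
have cQ j : (c ^+ (Q ^ j)) ^+ 2 = c ^+ 2.
  by rewrite exprAC cE exprMn (fixj a) // (exprNn_pchar _ (Qj j)) natr_frob.
have [v [v0 hv vE]] := closed_fiber_point_surj k0 hk c0 e0.
have f1 : normalized s (0 : K) 1.
  by split; rewrite ?expr1n ?mul0r ?mulr0 ?subr0 // expr0n gtn_eqF // expr0n gtn_eqF.
(* Otherwise [fiber_point_branch] gives u^n + a^n = 0 at e, as u is nonzero there, and the cofactor
   vanishes at e. *)
have hvv : (v ^+ s) ^+ s != v.
  apply/eqP => hvv; case: hW => [/eqP|]; first by rewrite (negbTE e0).
  have /eqP := fiber_point_branch hs k0 hk cE f1 hv.
  rewrite hvv subrr mulr0 !mul0r expr0n mulr0 vE mulf_eq0 subr_eq0 (negbTE ea) /=.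
  by rewrite sqrf_eq0 -sqr_cofactor // mulf_eq0 sqrf_eq0 (negbTE e0) /= => ->.
(* The middle coefficients 0, [l] and 1 have distinct squares; Frobenius fixes 0 and keeps [l]
   nonzero. *)
have [p1 hf1] : exists p, normalized s p (0 : K).
  by apply: closed_normalized => //; rewrite expr0n gtn_eqF.
have [p2 hf2] := closed_normalized hs h2 ls.
have FE p q : normalized s p q ->
    f_eval k a (fiber_point s k c p q v) = f_eval k a e.
  by move=> hf; rewrite -vE !(f_eval_fiber_point hs k0 hk cE) ?(uform_neq0 hs h2).
have inj p q p' q' := @fiber_point_inj K s k a c p q p' q' v hs h2 hk a0 cE.
exists (fiber_point s k c p1 0 v), (fiber_point s k c p2 l v); split; try exact: FE.
- apply/eqP; rewrite -vE => /(inj _ _ _ _ hf1 f1 hv hvv)/eqP.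
  by rewrite expr0n expr1n eq_sym oner_eq0.
- apply/eqP; rewrite -vE => /(inj _ _ _ _ hf2 f1 hv hvv)/eqP.
  by rewrite expr1n (negbTE l2).
move=> j; have frob p q (hf : normalized s p q) :=
  fiber_point_frob hs (Qj j) k0 hk c0 (cQ j) hf hv v0.
rewrite vE fixj // in frob.
split; apply/eqP.
  have [p' hf' ->] := frob _ _ hf1 erefl.
  rewrite expr0n gtn_eqF //= in hf' *.
  move/(inj _ _ _ _ hf' hf2 hv hvv)/eqP.
  by rewrite expr0n eq_sym sqrf_eq0 (negbTE l0).
have [p' hf' ->] := frob _ _ hf2 erefl.
move/(inj _ _ _ _ hf' hf1 hv hvv)/eqP.
by rewrite expr0n sqrf_eq0 expf_eq0 (negbTE l0) andbF.
Qed.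

(** * From [f_eval] to the polynomial [f_] *)

Lemma cofactor_rmorph (R S : comNzRingType) (h : {rmorphism R -> S}) (n : nat)
    (a y : R) :
  h (cofactor n a y) = cofactor n (h a) (h y).
Proof.
rewrite /cofactor rmorph_sum; apply: eq_bigr => i _.
by rewrite rmorphM !rmorphXn rmorphB rmorphN rmorphXn.
Qed.

Lemma f_eval_rmorph (R S : comNzRingType) (h : {rmorphism R -> S}) (k : nat)
    (a y : R) :
  h (f_eval k a y) = f_eval k (h a) (h y).
Proof. by rewrite /f_eval !rmorphM !rmorphXn rmorphB rmorphXn cofactor_rmorph. Qed.

Lemma f_eq_f_eval (F : finFieldType) (s k : nat) (a e : F) :
  (0 < k)%N -> s.+1 = (4 * k)%N -> f_ s a e = f_eval k a%:P ('X + e%:P).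
Proof.
move=> k0 hk; rewrite /f_ /f_eval.
have -> : ((s - 1) %/ 2 = (2 * k).-1)%N by lia.
have -> : ((s + 1) %/ 4 = k)%N by lia.
have -> : ((s + 1) %/ 2 = 2 * k)%N by lia.
set n := (2 * k).-1.
have nodd : odd n by rewrite /n -subn1 oddB ?oddM //; lia.
rewrite rmorphXn /= -sqr_cofactor // mulKp // expf_neq0 //.
exact/monic_neq0/monicXaddC.
Qed.

Lemma horner_map_f (F : finFieldType) (K : fieldType) (h : {rmorphism F -> K})
    (s k : nat) (a e : F) (x : K) :
  (0 < k)%N -> s.+1 = (4 * k)%N ->
  (map_poly h (f_ s a e)).[x] = f_eval k (h a) (x + h e).
Proof.
move=> k0 hk; rewrite (f_eq_f_eval _ _ k0 hk) f_eval_rmorph -/(horner_eval x _).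
rewrite f_eval_rmorph /= rmorphD /= !map_polyC /= map_polyX.
by rewrite !horner_evalE hornerD hornerX !hornerC.
Qed.

(** The cofactor enters with exponent 2k > 1, so its zeros are multiple roots. Goodness thereby
    excludes a zero at e. *)
Lemma deriv_f0 (F : finFieldType) (s k : nat) (a e : F) :
  (0 < k)%N -> s.+1 = (4 * k)%N -> cofactor (2 * k).-1 a e = 0 ->
  (f_ s a e)^`().[0] = 0.
Proof.
move=> k0 hk W0; rewrite (f_eq_f_eval _ _ k0 hk) /f_eval.
set w := cofactor _ _ _.
have w0 : w.[0] = 0.
  rewrite -/(horner_eval 0 w) cofactor_rmorph /= !horner_evalE.
  by rewrite hornerD hornerX !hornerC add0r.
rewrite derivM deriv_exp hornerD !hornerM !horner_exp w0.
rewrite !expr0n !gtn_eqF ?mulr0 ?addr0 //; last by lia.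
rewrite add0r hornerMn hornerM horner_exp w0 expr0n gtn_eqF.
  by rewrite !mulr0 mul0rn mulr0.
lia.
Qed.

Lemma root_reflected_quotient (F : finFieldType) (K : fieldType)
    (h : {rmorphism F -> K}) (g : {poly F}) (w : K) :
  g.[0] = 0 -> w != 0 -> (map_poly h g).[- w] = 0 ->
  root (map_poly h ((g \Po (- 'X)) %/ (- 'X))) w.
Proof.
move=> g0 w0 gw.
have dv : - 'X %| g \Po (- 'X).
  rewrite dvdpNl -[X in X %| _]subr0 -polyC0 dvdp_XsubCl.
  by rewrite root_comp hornerN hornerX oppr0; apply/rootP.
have /(congr1 (fun P => (map_poly h P).[w])) := divpK dv.
rewrite /= rmorphM /= rmorphN /= map_polyX hornerM hornerN hornerX.
rewrite map_comp_poly rmorphN /= map_polyX horner_comp hornerN hornerX gw.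
by move/eqP; rewrite mulf_eq0 oppr_eq0 (negbTE w0) orbF.
Qed.

(** * Frobenius orbits of the roots *)

Lemma iter_Frob (F : finFieldType) (k : nat) (z : Fbar F) :
  iter k (@Frob F) z = z ^+ (#|F| ^ k).
Proof.
by elim: k => [|k IH] //=; rewrite IH /Frob -exprM expnSr.
Qed.

Theorem proposition5p1 (F : finFieldType) (m r : nat) (a e : F) :
  #|F| = (3 ^ m)%N ->
  (3 < 3 ^ r)%N ->
  gcdn r (2 * m) = 1%N ->
  a != 0 ->
  (forall b : F, b ^+ 2 != a) ->
  ~ good (f_ (3 ^ r) a e - ((f_ (3 ^ r) a e).[0])%:P).
Proof.
move=> hq hr hg a0 ha [_ g0 g1 [z hz]].
have r1 : (1 < r)%N by case: r hr {hg g0 g1 hz} => [|[]].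
have rodd : odd r.
  apply: contraT; rewrite -dvdn2 => r2.
  have : (2 %| gcdn r (2 * m))%N by rewrite dvdn_gcd r2 dvdn_mulr.
  by rewrite hg.
pose k := ((3 ^ r).+1 %/ 4)%N.
(* For odd r, 3^r is 3 times a power of 9, and 9 is 1 modulo 4. *)
have r4 : (3 ^ r %% 4 = 3)%N.
  rewrite -(odd_double_half r) rodd expnD -mul2n expnM -modnMmr -modnXm.
  by rewrite exp1n.
have hk : (3 ^ r).+1 = (4 * k)%N by rewrite /k; lia.
have k1 : (1 < k)%N by lia.
have k0 : (0 < k)%N by lia.
pose K := Fbar F; pose h := toFbar F.
have h3 : 3 \in [pchar K] by rewrite (fmorph_pchar h) (card_finPcharP hq).
have nat3 j : [pchar K].-nat (3 ^ j)%N by rewrite pnatX pnatE ?h3.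
have hQ : [pchar K].-nat #|F| by rewrite hq.
have h2 : (2 : K) != 0 by rewrite -(dvdn_pcharf h3).
have hX (x : F) : h x ^+ #|F| = h x by rewrite -rmorphXn expf_card.
set g := _ - _ in g0 g1 hz.
have hW : h e = 0 \/ cofactor (2 * k).-1 (h a) (h e) != 0.
  right; rewrite -cofactor_rmorph fmorph_eq0; apply: contraNneq g1 => W0.
  by rewrite /g derivB derivC subr0 (deriv_f0 k0 hk W0).
have ha0 : h a != 0 by rewrite fmorph_eq0.
have hea : h e ^+ 2 != h a by rewrite -rmorphXn fmorph_eq.
have [y1 [y2 [ne1 ne2 F1 F2 nc]]] :=
  non_conjugate_roots (nat3 r) hQ h2 k1 hk ha0 (hX a) (hX e) hea hW.
(* The root w = e - y of the reflected quotient satisfies g(-w) = f_0(y) - f_0(e); it is nonzero as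
   y differs from e. *)
have orb y : y != h e -> f_eval k (h a) y = f_eval k (h a) (h e) ->
    exists j, h e - y = z ^+ (#|F| ^ j).
  move=> ne FE; case: (hz (h e - y)) => [+ _]; case.
    apply: root_reflected_quotient => //; first by rewrite subr_eq0 eq_sym.
    rewrite /g rmorphB /= map_polyC hornerD hornerN hornerC.
    rewrite (horner_map_f _ _ _ _ k0 hk) opprB subrK FE.
    have := horner_map h (f_ (3 ^ r) a e) 0.
    by rewrite rmorph0 (horner_map_f _ _ _ _ k0 hk) add0r => ->; exact: subrr.
  by move=> j jE; exists j; rewrite jE iter_Frob.
(* Since e is rational, conjugacy of e - y and e - y' passes to y and y'. *)
have conj y y' i j : h e - y = z ^+ (#|F| ^ i) -> h e - y' = z ^+ (#|F| ^ j) ->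
    (i <= j)%N -> y ^+ (#|F| ^ (j - i)) = y'.
  move=> yE y'E ij; apply: (addrI (- h e)); apply: oppr_inj.
  have hQj : [pchar K].-nat (#|F| ^ (j - i))%N by rewrite pnatX hQ.
  rewrite !opprD !opprK y'E -{2}(subnKC ij) expnD exprM -yE.
  rewrite (exprDn_pchar _ _ hQj) (exprNn_pchar _ hQj); congr (_ - _).
  by elim: (j - i)%N => // l IH; rewrite expnS exprM hX.
have [i iE] := orb _ ne1 F1; have [j jE] := orb _ ne2 F2.
(* Orbits are given by forward iterates, so either root may be the earlier one. *)
case/orP: (leq_total i j) => ij.
  by have [/eqP ne _] := nc (j - i)%N; apply: ne; exact: conj iE jE ij.
by have [_ /eqP ne] := nc (i - j)%N; apply: ne; exact: conj jE iE ij.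
Qed.
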